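(* Let $d\ge3$. For each $\gamma\in[-d,-2]$ there is a constant $C=C(d,\gamma)$ such that for any non-negative $f\in L^1(\mathbb{R}^d)$ (not a.e. zero) and any cube $Q\subset\mathbb{R}^d$, $$|Q|^{\frac1d}\left(⨍_Qh_{f,\gamma}\,dv\right)^{\frac12}\left(⨍_Q(a_{f,\gamma})^{-1}\,dv\right)^{\frac12}\le C(d,\gamma).$$
   Context: $⨍_Q=\frac1{|Q|}\int_Q$. For $f\ge0$, $a_{f,\gamma}(v)=C(d,\gamma)\int_{\mathbb{R}^d}f(w)|v-w|^{2+\gamma}\,dw$, and $h_{f,\gamma}=f$ if $\gamma=-d$, $h_{f,\gamma}(v)=c(d,\gamma)\int_{\mathbb{R}^d}f(w)|v-w|^\gamma\,dw$ if $\gamma>-d$, where $C(d,\gamma),c(d,\gamma)>0$ are fixed constants depending only on $d$ and $\gamma$. *)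

(* Defs.v *)
From HB Require Import structures.
From mathcomp Require Import all_boot all_order all_algebra.
From mathcomp Require Import all_classical all_reals all_analysis.

Set Implicit Arguments.
Unset Strict Implicit.
Unset Printing Implicit Defensive.

Import Order.TTheory GRing.Theory Num.Theory.
Import numFieldNormedType.Exports.

Local Open Scope classical_set_scope.
Local Open Scope ring_scope.

Section product_tuple.
Context dp (T : measurableType dp) (R : realType).

Definition cons_tuple n (p : T * n.-tuple T) : n.+1.-tuple T :=
  [the n.+1.-tuple T of p.1 :: p.2].

Lemma measurable_cons_tuple n : measurable_fun setT (@cons_tuple n).
Proof. exact: measurable_cons measurable_fst measurable_snd. Qed.

Section cons.
Context (m1 : {sigma_finite_measure set T -> \bar R}) (n : nat).
Context (m2 : {sigma_finite_measure set (n.-tuple T) -> \bar R}).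

Definition cons_measure : set (n.+1.-tuple T) -> \bar R :=
  pushforward (m1 \x m2)%E (@cons_tuple n).

Let cons_measure0 : cons_measure set0 = 0%E.
Proof. by apply: measure0; exact: measurable_cons_tuple. Qed.

Let cons_measure_ge0 A : (0 <= cons_measure A)%E.
Proof. by apply: measure_ge0; exact: measurable_cons_tuple. Qed.

Let cons_measure_sigma_additive : semi_sigma_additive cons_measure.
Proof. by apply: measure_semi_sigma_additive; exact: measurable_cons_tuple. Qed.

HB.instance Definition _ := isMeasure.Build _ _ _ cons_measure
  cons_measure0 cons_measure_ge0 cons_measure_sigma_additive.

Lemma cons_measure_sigma_finite : sigma_finite setT cons_measure.
Proof.
have /sigma_finiteP[F [FT ndF Foo]] := sigma_finiteT m1.
have /sigma_finiteP[G [GT ndG Goo]] := sigma_finiteT m2.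
pose uncons (t : n.+1.-tuple T) : (T * n.-tuple T)%type :=
  (thead t, [tuple of behead t]).
have consK : cancel (@cons_tuple n) uncons.
  by move=> [x t]; apply/pair_equal_spec; split => //; exact: val_inj.
have muncons : measurable_fun setT uncons.
  by apply: measurable_fun_pair; [exact: measurable_tnth|exact: measurable_behead].
exists (fun i => uncons @^-1` (F i `*` G i)).
  rewrite -preimage_bigcup (_ : \bigcup_i _ = setT) ?preimage_setT//.
  apply/seteqP; split => // -[x t] _.
  have [i _ Fx] : (\bigcup_i F i) x by rewrite -FT.
  have [j _ Gt] : (\bigcup_i G i) t by rewrite -GT.
  exists (maxn i j) => //; split.
  - by move: x Fx; exact/subsetPset/ndF/leq_maxl.
  - by move: t Gt; exact/subsetPset/ndG/leq_maxr.
move=> i; have [mF Fi] := Foo i; have [mG Gi] := Goo i; split.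
  by rewrite -[X in measurable X]setTI; apply: muncons => //; exact: measurableX.
rewrite /cons_measure /pushforward -comp_preimage.
rewrite (_ : uncons \o _ = id); last by apply/funext => x; exact: consK.
by rewrite preimage_id product_measure1E// lte_mul_pinfty// ge0_fin_numE.
Qed.

HB.instance Definition _ := Measure_isSigmaFinite.Build _ _ _ cons_measure
  cons_measure_sigma_finite.

End cons.

Context (m : {sigma_finite_measure set T -> \bar R}).

Fixpoint product_tuple (n : nat) : {sigma_finite_measure set (n.-tuple T) -> \bar R} :=
  match n with
  | 0 => dirac ([tuple] : 0.-tuple T)
  | n.+1 => cons_measure m (product_tuple n)
  end.

Lemma product_tuple_box n (A : 'I_n -> set T) :
  (forall i, measurable (A i)) ->
  product_tuple n [set t | forall i, A i (tnth t i)] = (\prod_(i < n) m (A i))%E.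
Proof.
elim: n A => [|n IHn] A mA.
  by rewrite big_ord0 /= diracE mem_set//; case.
rewrite big_ord_recl /= /cons_measure /pushforward.
set B := [set t : n.-tuple T | forall i, A (lift ord0 i) (tnth t i)].
have mB : measurable B.
  rewrite (_ : B = \bigcap_(i in [set: 'I_n])
      ((fun t : n.-tuple T => tnth t i) @^-1` A (lift ord0 i))).
    apply: fin_bigcap_measurable => // i _.
    by rewrite -[X in measurable X]setTI; exact: measurable_tnth.
  by apply/seteqP; split => t Bt i; [move=> _; exact: Bt | exact: Bt].
rewrite (_ : _ @^-1` _ = A ord0 `*` B).
  by rewrite product_measure1E//; congr (_ * _)%E; exact: IHn.
apply/seteqP; split => -[x t] /=.
  by move=> Axt; split => [|i]; [have := Axt ord0; rewrite tnth0
    | have := Axt (lift ord0 i); rewrite tnthS].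
move=> [Ax Bt] i; case: (unliftP ord0 i) => [j ->|->].
  by rewrite tnthS; exact: Bt.
by rewrite tnth0.
Qed.

End product_tuple.

(* R^d, as d-tuples of reals with the product of the Borel sigma-algebras, and
   Lebesgue measure on it. *)
Notation Rn R d := (d.-tuple (measurableTypeR R)).

Definition lebesgue_tuple (R : realType) (d : nat) :
    {sigma_finite_measure set (Rn R d) -> \bar R} :=
  product_tuple (@lebesgue_measure R) d.

Section coefficients.
Context (R : realType) (d : nat).
Implicit Types (f : Rn R d -> R) (g : Rn R d -> \bar R) (v w : Rn R d).

Definition eucl_dist v w : R := Num.sqrt (\sum_(i < d) (tnth v i - tnth w i) ^+ 2).

(* A closed cube of side l with corner p, with edges along the columns of the
   orthogonal matrix U (U = 1 for sides parallel to the axes). *)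
Definition cube (p : Rn R d) (U : 'M[R]_d) (l : R) : set (Rn R d) :=
  [set v | forall j, 0 <= \sum_(i < d) (tnth v i - tnth p i) * U i j <= l].

Definition is_cube (Q : set (Rn R d)) : Prop :=
  exists p (U : 'M[R]_d) (l : R), [/\ U^T *m U = 1%:M, 0 < l & Q = cube p U l].

Local Open Scope ereal_scope.
Local Notation mu := (lebesgue_tuple R d).

Definition avg (Q : set (Rn R d)) g : \bar R := (mu Q)^-1 * \int[mu]_(v in Q) g v.

(* The kernels are real-valued: for a negative exponent, powR gives 0 instead
   of +oo at w = v, which is a null set. The integrals may be +oo. Ca and ch are
   the normalising constants, which depend on d and gamma only. *)
Definition a_coef (Ca gamma : R) f v : \bar R :=
  Ca%:E * \int[mu]_w (f w * eucl_dist v w `^ (2 + gamma))%:E.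

Definition h_coef (ch gamma : R) f v : \bar R :=
  if gamma == (- d%:R)%R then (f v)%:E
  else ch%:E * \int[mu]_w (f w * eucl_dist v w `^ gamma)%:E.

End coefficients.

(* Main.v *)
Require Import Defs.
From HB Require Import structures.
From mathcomp Require Import all_boot all_order all_algebra.
From mathcomp Require Import all_classical all_reals all_analysis.
From mathcomp Require Import measurable_realfun ring lra.

(* For a cube Q of side l and every v in Q, the pointwise bound
   |Q|^(2/d) avg_Q h <= k a(v) holds with k depending only on d and gamma, and
   averaging 1/a over Q gives the claim. For gamma > -d, Tonelli's theorem
   reduces the bound to a comparison of kernels,
     int_Q |u - w|^gamma du <= K l^(d-2) |v - w|^(2+gamma)   for w <> v:
   if w is far from v then |u - w| is comparable to |v - w| >= 2 d l on Q, and
   otherwise the integral is O(l^(d+gamma)) while |v - w|^(2+gamma) is at least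
   of order l^(2+gamma). For gamma = -d the comparison is just
   1 <= (d l)^(d-2) |v - w|^(2-d) for v, w in Q. The measure of a rotated cube
   is only needed up to constants, so inscribed and circumscribed axis-parallel
   boxes suffice. *)

Set Implicit Arguments.
Unset Strict Implicit.
Unset Printing Implicit Defensive.

Import Order.TTheory GRing.Theory Num.Theory.
Import numFieldNormedType.Exports.

Local Open Scope classical_set_scope.
Local Open Scope ring_scope.

(** * Euclidean distance, axis-parallel boxes and rotated cubes *)

Section euclidean.
Context {R : realType} {d : nat}.
Implicit Types (u v w p c : Rn R d) (U : 'M[R]_d) (l r : R).
Local Notation mu := (lebesgue_tuple R d).

Lemma sqr_eucl_dist v w :
  eucl_dist v w ^+ 2 = \sum_(i < d) (tnth v i - tnth w i) ^+ 2.
Proof. by rewrite sqr_sqrtr// sumr_ge0// => i _; rewrite sqr_ge0. Qed.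

Lemma eucl_dist_ge0 v w : 0 <= eucl_dist v w.
Proof. exact: sqrtr_ge0. Qed.

Lemma eucl_distC v w : eucl_dist v w = eucl_dist w v.
Proof.
by congr Num.sqrt; apply: eq_bigr => i _; rewrite -sqrrN opprB.
Qed.

Lemma le_coord_eucl_dist v w i : `|tnth v i - tnth w i| <= eucl_dist v w.
Proof.
rewrite -(@ler_pXn2r _ 2)// ?nnegrE ?eucl_dist_ge0// sqr_eucl_dist real_normK ?num_real//.
by rewrite (bigD1 i)//= lerDl sumr_ge0// => j _; rewrite sqr_ge0.
Qed.

Lemma eucl_dist_gt0 v w : v <> w -> 0 < eucl_dist v w.
Proof.
move=> vw; rewrite lt_neqAle eucl_dist_ge0 andbT eq_sym; apply/eqP => d0.
apply: vw; apply: eq_from_tnth => i; apply/eqP; rewrite -subr_eq0 -normr_le0.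
by rewrite -d0 le_coord_eucl_dist.
Qed.

(** Coordinatewise this is [(s + t)^2 <= 2 s^2 + 2 t^2]. The squared form replaces the triangle
    inequality: the factor 2 only costs constants, and no square root or Cauchy-Schwarz enters. *)
Lemma sqr_eucl_dist_triangle u v w :
  eucl_dist v w ^+ 2 <= 2 * eucl_dist v u ^+ 2 + 2 * eucl_dist u w ^+ 2.
Proof.
rewrite !sqr_eucl_dist !mulr_sumr -big_split/=; apply: ler_sum => i _.
have := sqr_ge0 (tnth v i - tnth u i - (tnth u i - tnth w i)); lra.
Qed.

Lemma measurable_eucl_dist :
  measurable_fun [set: (Rn R d * Rn R d)%type] (fun z => eucl_dist z.1 z.2).
Proof.
rewrite (_ : (fun z : (Rn R d * Rn R d)%type => _) =
    (@powR R ^~ 2^-1) \o (fun z => \sum_(i < d) (tnth z.1 i - tnth z.2 i) ^+ 2)).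
  apply: measurableT_comp; first exact: measurable_powR.
  apply: measurable_sum => i; apply: measurable_funX; apply: measurable_funB.
    exact: measurableT_comp (measurable_tnth i) measurable_fst.
  exact: measurableT_comp (measurable_tnth i) measurable_snd.
apply/funext => z /=; rewrite powR12_sqrt//.
by rewrite sumr_ge0// => i _; rewrite sqr_ge0.
Qed.

(** The closed sup-norm ball, a product of intervals and so of explicit measure; it stands in for
    Euclidean balls and for rotated cubes. *)
Definition box c r : set (Rn R d) :=
  [set v | forall i, `|tnth v i - tnth c i| <= r].

Let boxE c r : box c r =
  [set v | forall i, [set` `[tnth c i - r, tnth c i + r]] (tnth v i)].
Proof.
by apply/seteqP; split => v /= Bv i; have := Bv i; rewrite /= in_itv/= ler_distl.
Qed.

Lemma measurable_box c r : measurable (box c r).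
Proof.
rewrite boxE (_ : [set v | _] = \bigcap_(i in [set: 'I_d])
    ((fun t : Rn R d => tnth t i) @^-1` [set` `[tnth c i - r, tnth c i + r]])).
  apply: fin_bigcap_measurable => // i _.
  by rewrite -[X in measurable X]setTI; apply: measurable_tnth.
by apply/seteqP; split => t Bt i; [move=> _; exact: Bt | exact: Bt].
Qed.

Lemma lebesgue_tuple_box c r : 0 <= r -> mu (box c r) = ((2 * r) ^+ d)%:E.
Proof.
move=> r0; rewrite boxE /lebesgue_tuple.
rewrite (product_tuple_box (@lebesgue_measure R)
  (A := fun i => [set` `[tnth c i - r, tnth c i + r]])) => [|i]; last exact: measurable_itv.
rewrite (eq_bigr (fun=> (2 * r)%:E)) => [|i _].
  by rewrite big_const_ord; elim: d => [//|n /= ->]; rewrite -EFinM exprS.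
apply: (etrans (lebesgue_measure_itv `[tnth c i - r, tnth c i + r])).
rewrite /= lte_fin; case: ifPn => [_|].
  by rewrite -EFinB; congr EFin; ring.
by rewrite -leNgt => ?; congr EFin; lra.
Qed.

(** Makes points measurable and, for [0 < d], null by the box formula. *)
Lemma set1_box v : [set v] = box v 0.
Proof.
apply/seteqP; split => [w -> i|w vw]; first by rewrite subrr normr0.
apply: eq_from_tnth => i; apply/eqP; rewrite -subr_eq0 -normr_le0.
exact: vw.
Qed.

Lemma lebesgue_tuple_set1 v : (0 < d)%N -> mu [set v] = 0.
Proof.
by move=> d0; rewrite set1_box lebesgue_tuple_box// mulr0 expr0n eqn0Ngt d0.
Qed.

(** Right multiplication of a row vector by [U] is an isometry, because [U^T U = 1] forces
    [U U^T = 1] for square matrices. *)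
Lemma orthogonal_sum_sqr U (x : 'I_d -> R) : U^T *m U = 1%:M ->
  \sum_j (\sum_i x i * U i j) ^+ 2 = \sum_i x i ^+ 2.
Proof.
move=> /mulmx1C UU; pose y := \row_i x i.
have sqr_sum (z : 'rV[R]_d) : \sum_j z 0 j ^+ 2 = (z *m z^T) 0 0.
  by rewrite mxE; apply: eq_bigr => j _; rewrite mxE.
transitivity (\sum_j y 0 j ^+ 2); last by apply: eq_bigr => j _; rewrite mxE.
transitivity (\sum_j (y *m U) 0 j ^+ 2).
  apply: eq_bigr => j _; rewrite mxE; congr (_ ^+ 2).
  by apply: eq_bigr => i _; rewrite mxE.
by rewrite !sqr_sum trmx_mul mulmxA -(mulmxA y) UU mulmx1.
Qed.

(** In the rotated coordinates each component of [u - v] lies in [[-l, l]], so the squared distance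
    is at most [d l^2], which is bounded by [(d l)^2] to keep the constant free of roots. *)
Lemma cube_diameter p U l u v : U^T *m U = 1%:M -> 0 <= l ->
  cube p U l u -> cube p U l v -> eucl_dist u v <= d%:R * l.
Proof.
move=> UU l0 Qu Qv; rewrite -(@ler_pXn2r _ 2)// ?nnegrE ?eucl_dist_ge0// ?mulr_ge0//.
rewrite sqr_eucl_dist -(orthogonal_sum_sqr _ UU).
apply: (@le_trans _ _ (\sum_(j < d) l ^+ 2)).
  apply: ler_sum => j _; rewrite -ler_sqrt ?sqr_ge0// !sqrtr_sqr (ger0_norm l0).
  have := Qu j; have := Qv j.
  have -> : \sum_i (tnth u i - tnth v i) * U i j =
      \sum_i (tnth u i - tnth p i) * U i j - \sum_i (tnth v i - tnth p i) * U i j.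
    by rewrite -sumrB; apply: eq_bigr => i _; ring.
  by move=> /andP[? ?] /andP[? ?]; rewrite ler_norml; apply/andP; split; lra.
rewrite sumr_const card_ord -[leLHS]mulr_natl exprMn ler_wpM2r ?sqr_ge0//.
by rewrite -natrX ler_nat; case: d => // n; rewrite leq_pmulr.
Qed.

Lemma cube_sub_box p U l : U^T *m U = 1%:M -> 0 <= l ->
  cube p U l `<=` box p (d%:R * l).
Proof.
move=> UU l0 v Qv i; apply: le_trans (le_coord_eucl_dist _ _ _) _.
(* The corner [p] belongs to the cube, all its rotated coordinates being 0. *)
apply: (cube_diameter UU l0 Qv) => j.
by rewrite big1 ?lexx// => k _; rewrite subrr mul0r.
Qed.

Lemma box_sub_cube p U l : U^T *m U = 1%:M -> 0 < l ->
  exists c, box c (l / (2 * d%:R)) `<=` cube p U l.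
Proof.
(* The box is centred at the centre of the cube, [p] plus [l/2] along every column of [U]; its
   rotated coordinates are all [l/2]. Entries of [U] are at most 1 in absolute value, so moving each
   coordinate by at most [l/(2d)] changes a rotated coordinate by at most [l/2]. *)
move=> UU l0; exists (mktuple (fun i => tnth p i + \sum_k U i k * (l / 2))) => v Bv j.
have Uj : \sum_i U i j ^+ 2 = 1.
  have := congr1 (fun M : 'M[R]_d => M j j) UU.
  by rewrite !mxE eqxx mulr1n => <-; apply: eq_bigr => i _; rewrite mxE.
have U1 i : `|U i j| <= 1.
  rewrite -(@ler_pXn2r _ 2)// ?nnegrE// expr1n real_normK ?num_real// -Uj.
  by rewrite (bigD1 i)//= lerDl sumr_ge0// => k _; rewrite sqr_ge0.
have -> : \sum_i (tnth v i - tnth p i) * U i j =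
    \sum_i (tnth v i - (tnth p i + \sum_k U i k * (l / 2))) * U i j + l / 2.
  have E : l / 2 = \sum_i (\sum_k U i k * (l / 2)) * U i j.
    under eq_bigr do rewrite -mulr_suml mulrAC mulr_suml.
    rewrite -mulr_suml exchange_big/= (eq_bigr (fun k => (U^T *m U) k j)).
      rewrite UU (bigD1 j)//= mxE eqxx big1 ?addr0 ?mul1r// => k kj.
      by rewrite mxE (negbTE kj).
    by move=> k _; rewrite mxE; apply: eq_bigr => i _; rewrite mxE.
  by rewrite [X in _ + X]E -big_split/=; apply: eq_bigr => i _; ring.
set S := \sum_i _; suff : `|S| <= l / 2.
  by rewrite ler_norml => /andP[? ?]; apply/andP; split; lra.
apply: le_trans (ler_norm_sum _ _ _) _.
apply: (@le_trans _ _ (\sum_(i < d) l / (2 * d%:R))).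
  apply: ler_sum => i _; rewrite normrM -[leRHS]mulr1 ler_pM//.
  by have := Bv i; rewrite tnth_mktuple.
rewrite sumr_const card_ord -[leLHS]mulr_natl.
have d0 : d%:R != 0 :> R by rewrite pnatr_eq0 -lt0n (leq_ltn_trans _ (ltn_ord j)).
by rewrite [leLHS](_ : _ = l / 2)//; field.
Qed.

Lemma measurable_cube p U l : measurable (cube p U l).
Proof.
rewrite (_ : cube p U l = \bigcap_(j in [set: 'I_d])
    ((fun t : Rn R d => \sum_i (tnth t i - tnth p i) * U i j) @^-1` [set` `[0, l]])).
  apply: fin_bigcap_measurable => // j _.
  rewrite -[X in measurable X]setTI.
  suff : measurable_fun [set: Rn R d]
      (fun t => \sum_(i < d) (tnth t i - tnth p i) * U i j).
    by apply => //; exact: measurable_itv.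
  apply: measurable_sum => i; apply: measurable_funM => //.
  by apply: measurable_funB => //; exact: measurable_tnth.
by apply/seteqP; split => t Qt j; have := Qt j; rewrite /= in_itv/=; [move=> + _|move=> /(_ I)].
Qed.

(** The lower bound will control the factor [1/|Q|] of the average of [h], the upper bound the
    factor [|Q|^(1/d)]. *)
Lemma cube_measure p U l : U^T *m U = 1%:M -> 0 < l ->
  exists2 m : R, mu (cube p U l) = m%:E &
    (l / d%:R) ^+ d <= m <= (2 * (d%:R * l)) ^+ d.
Proof.
move=> UU l0; have [c cQ] := box_sub_cube p UU l0.
have mQ := measurable_cube p U l.
have ub : (mu (cube p U l) <= ((2 * (d%:R * l)) ^+ d)%:E)%E.
  rewrite -(lebesgue_tuple_box p) ?mulr_ge0 ?(ltW l0)//.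
  apply: le_measure; rewrite ?inE//; first exact: measurable_box.
  by apply: cube_sub_box => //; exact: ltW.
have lb : (((l / d%:R) ^+ d)%:E <= mu (cube p U l))%E.
  have -> : l / d%:R = 2 * (l / (2 * d%:R)) by rewrite invfM mulrCA mulVKf.
  rewrite -(lebesgue_tuple_box c) ?divr_ge0 ?mulr_ge0 ?(ltW l0)//.
  by apply: le_measure; rewrite ?inE//; exact: measurable_box.
have muQ : mu (cube p U l) \is a fin_num.
  by rewrite ge0_fin_numE// (le_lt_trans ub) ?ltry.
exists (fine (mu (cube p U l))); first by rewrite fineK.
by rewrite -!lee_fin fineK// lb ub.
Qed.

End euclidean.

(** * Negative powers, geometric series and dyadic scales *)

Lemma le0_ler_powR (R : realType) (r x y : R) :
  r <= 0 -> 0 < x -> x <= y -> y `^ r <= x `^ r.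
Proof.
move=> r0 x0 xy; have y0 := lt_le_trans x0 xy.
rewrite -[r]opprK !(powRN _ (- r)) lef_pV2 ?posrE ?powR_gt0//.
by apply: ge0_ler_powR; rewrite ?nnegrE ?oppr_ge0// ltW.
Qed.

Lemma nneseries_geometric (R : realType) (a q : R) : 0 <= q -> q < 1 ->
  (\sum_(0 <= n <oo) (a * q ^+ n)%:E = (a / (1 - q))%:E)%E.
Proof.
move=> q0 q1; have /cvg_geometric_series qcvg : `|q| < 1 by rewrite ger0_norm.
apply/cvg_lim => //.
rewrite (_ : (fun n => _) = EFin \o series (geometric a q)).
  by apply: cvg_EFin; [exact: nearW|exact: qcvg].
by apply/funext => n /=; rewrite -sumEFin.
Qed.

(** Take the least [n] satisfying the lower bound; minimality gives the upper bound, except for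
    [n = 0], where it is [x <= r]. *)
Lemma dyadic_shell (R : realType) (r x : R) : 0 < x -> x <= r ->
  exists n, r * 2^-1 ^+ n.+1 <= x <= r * 2^-1 ^+ n.
Proof.
move=> x0 xr; have r0 := lt_le_trans x0 xr.
have ex : exists n, r * 2^-1 ^+ n.+1 <= x.
  (* With this [n], [r / x < n + 1 < 2^(n+1)]. *)
  exists (Num.truncn (r / x)).
  rewrite exprVn ler_pdivrMr ?exprn_gt0// mulrC -ler_pdivrMr//.
  apply: ltW; apply: lt_le_trans (truncnS_gt _) _.
  by rewrite -natrX ler_nat ltnW// ltn_expl.
case: (ex_minnP ex) => -[|n] le_n min_n.
  by exists 0%N; rewrite le_n expr0 mulr1.
exists n.+1; rewrite le_n/= leNgt; apply/negP => lt_n.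
by have := min_n n (ltW lt_n); rewrite ltnn.
Qed.

(** * Local integrability of the kernel, with its scaling *)

Section kernel.
Context {R : realType} {d : nat}.
Implicit Types (u v w p c : Rn R d) (l r : R).
Local Notation mu := (lebesgue_tuple R d).

Lemma measurable_powR_eucl_dist a :
  measurable_fun [set: (Rn R d * Rn R d)%type] (fun z => eucl_dist z.1 z.2 `^ a).
Proof.
exact: measurableT_comp (measurable_powR a) measurable_eucl_dist.
Qed.

Lemma measurable_powR_eucl_distl a w :
  measurable_fun [set: Rn R d] (fun u => eucl_dist u w `^ a).
Proof.
exact: (measurableT_comp (measurable_powR_eucl_dist a) (pair2_measurable w)).
Qed.

Lemma measurable_powR_eucl_distr a v :
  measurable_fun [set: Rn R d] (fun w => eucl_dist v w `^ a).
Proof.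
by under eq_fun do rewrite eucl_distC; exact: measurable_powR_eucl_distl.
Qed.

(* Cover [D] by the boxes of half-side r / 2^n around w; where r / 2^(n+1) <=
   |u - w| <= r / 2^n, the kernel is at most (r / 2^(n+1))^a. *)
Lemma integral_kernel_le a : - d%:R < a -> a < 0 ->
  exists2 K, 0 <= K & forall (D : set (Rn R d)) w r, 0 < r -> measurable D ->
    (forall u, D u -> eucl_dist u w <= r) ->
    (\int[mu]_(u in D) (eucl_dist u w `^ a)%:E <= (K * (r `^ a * r ^+ d))%:E)%E.
Proof.
(* At scale [n] the kernel is at most [(r s^(n+1))^a] and the box has measure [(2 r s^n)^d]; the
   product is [2^d s^a r^a r^d q^n]. The ratio [q = s^(a+d)] is below 1 because [-d < a]. *)
move=> da a0; pose s : R := 2^-1; pose q := s `^ a * s ^+ d.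
have s0 : 0 < s by rewrite invr_gt0.
have q0 : 0 <= q by rewrite mulr_ge0 ?powR_ge0// exprn_ge0// ltW.
have q1 : q < 1.
  rewrite /q -powR_mulrn ?ltW// -powRD; last by rewrite (gt_eqF s0) implybT.
  rewrite -[ltRHS](_ : 1 `^ (a + d%:R) = 1); last by rewrite powR1.
  apply: gt0_ltr_powR; rewrite ?nnegrE ?ltW//.
    by lra.
  by rewrite /s invf_lt1 ?ltr1n.
exists (2 ^+ d * s `^ a / (1 - q)).
  by rewrite divr_ge0 ?mulr_ge0 ?powR_ge0 ?exprn_ge0// subr_ge0 ltW.
move=> D w r r0 mD Dr.
pose E n := box w (r * s ^+ n); pose c n := (r * s ^+ n.+1) `^ a.
have rs0 n : 0 < r * s ^+ n by rewrite mulr_gt0// exprn_gt0.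
have mF n : measurable_fun D (fun u => (c n * \1_(E n) u)%:E).
  apply/measurable_EFinP; apply: measurable_funM => //.
  by apply: measurable_indic; exact: measurable_box.
have F0 n u : (0 <= (c n * \1_(E n) u)%:E)%E.
  by rewrite lee_fin mulr_ge0 ?powR_ge0.
have le_sum : (\int[mu]_(u in D) (eucl_dist u w `^ a)%:E <=
    \int[mu]_(u in D) \sum_(0 <= n <oo) (c n * \1_(E n) u)%:E)%E.
  apply: ge0_le_integral => //.
  - by move=> u _; rewrite lee_fin powR_ge0.
  - apply/measurable_EFinP; apply: measurable_funS (measurable_powR_eucl_distl a w) => //.
  - by apply: ge0_emeasurable_sum.
  (* No shell contains [w] itself, but there the kernel takes the default value 0. *)
  move=> u Du; have [->|uw] := eqVneq u w.
    rewrite (_ : eucl_dist w w = 0).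
      by rewrite powR0 ?lt_eqF//; apply: nneseries_ge0.
    by rewrite /eucl_dist big1 ?sqrtr0// => i _; rewrite subrr expr0n.
  have x0 : 0 < eucl_dist u w by apply/eucl_dist_gt0/eqP.
  have [n /andP[ge_n le_n]] := dyadic_shell x0 (Dr u Du).
  apply: (@le_trans _ _ (c n * \1_(E n) u)%:E).
    rewrite lee_fin indicE mem_set ?mulr1.
      by apply: le0_ler_powR; rewrite ?(ltW a0).
    by move=> i; apply: le_trans (le_coord_eucl_dist u w i) le_n.
  apply: le_trans (nneseries_lim_ge n.+1 _) => //.
  by rewrite big_nat_recr//= leeDr// sume_ge0.
apply: (le_trans le_sum); rewrite integral_nneseries//.
have -> : 2 ^+ d * s `^ a / (1 - q) * (r `^ a * r ^+ d) =
   (2 ^+ d * s `^ a * (r `^ a * r ^+ d)) / (1 - q) by rewrite mulrAC.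
rewrite -nneseries_geometric//.
apply: lee_nneseries => [n _ _|n _]; first by apply: integral_ge0.
apply: (@le_trans _ _ (\int[mu]_u (c n * \1_(E n) u)%:E)%E).
  apply: ge0_subset_integral => //; apply/measurable_EFinP; apply: measurable_funM => //.
  by apply: measurable_indic; exact: measurable_box.
under eq_integral do rewrite EFinM.
rewrite ge0_integralZl_EFin ?powR_ge0//; last first.
  by apply/measurable_EFinP/measurable_indic; exact: measurable_box.
rewrite integral_indic//; last exact: measurable_box.
rewrite [X in (_ * X)%E](_ : _ = ((2 * (r * s ^+ n)) ^+ d)%:E); last first.
  by rewrite setIT; exact: (lebesgue_tuple_box w (ltW (rs0 n))).
rewrite -EFinM lee_fin.
rewrite /c powRM ?exprn_ge0 ?(ltW r0) ?(ltW s0)// -powR_mulrn ?(ltW s0)// powRAC powR_mulrn ?powR_ge0//.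
rewrite exprS /q !exprMn -!exprM (mulnC n d) !exprM.
by rewrite le_eqVlt; apply/orP; left; apply/eqP; ring.
Qed.

End kernel.

(** * Comparison of kernels over a cube, and its integrated form *)

Lemma powR2D (R : realType) (x a : R) : 0 < x -> x `^ (2 + a) = x ^+ 2 * x `^ a.
Proof.
move=> x0; rewrite powRD; last by rewrite (gt_eqF x0) implybT.
by rewrite (powR_mulrn 2) ?(ltW x0).
Qed.

Section cube_kernel.
Context {R : realType} {d : nat} (d_gt0 : (0 < d)%N).
Implicit Types (u v w p c : Rn R d) (l r : R) (U : 'M[R]_d).
Local Notation mu := (lebesgue_tuple R d).

Let dR : 1 <= d%:R :> R. Proof. by rewrite ler1n. Qed.

Lemma integral_cube_kernel_le a : - d%:R < a -> a <= - 2 ->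
  exists2 K, 0 <= K & forall p U l v w, U^T *m U = 1%:M -> 0 < l ->
    cube p U l v -> w <> v ->
    (\int[mu]_(u in cube p U l) (eucl_dist u w `^ a)%:E <=
      (K * (l ^+ d / l ^+ 2) * eucl_dist v w `^ (2 + a))%:E)%E.
Proof.
move=> da a2; have a0 : a < 0 by lra.
have [K K0 Kle] := integral_kernel_le da a0.
(* Far case, with [x = |v - w| >= 2 d l]: the integral is at most [(x/2)^a (2 d l)^d], and [x^a =
   x^(2+a) / x^2 <= x^(2+a) / (2 d l)^2]. *)
pose K1 := 2^-1 `^ a * ((2 * d%:R) ^+ d / (2 * d%:R) ^+ 2).
(* Near case, with [r = 4 d l >= x]: the integral is at most [K r^a r^d], and
   [r^a = r^(2+a) / r^2 <= x^(2+a) / r^2] because [2 + a <= 0]. *)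
pose K2 := K * ((4 * d%:R) ^+ d / (4 * d%:R) ^+ 2).
have K10 : 0 <= K1 by rewrite mulr_ge0 ?powR_ge0// divr_ge0 ?exprn_ge0// mulr_ge0.
have K20 : 0 <= K2 by rewrite mulr_ge0// divr_ge0 ?exprn_ge0// mulr_ge0.
exists (K1 + K2); first by rewrite addr_ge0.
move=> p U l v w UU l0 Qv wv.
have mQ := measurable_cube p U l.
set x := eucl_dist v w; have x0 : 0 < x by apply: eucl_dist_gt0 => /esym.
have dl0 : 0 < d%:R * l by rewrite mulr_gt0// ltr0n.
have P0 : 0 <= (l ^+ d / l ^+ 2) * x `^ (2 + a).
  by rewrite mulr_ge0 ?powR_ge0// divr_ge0 ?exprn_ge0// ltW.
have diam u : cube p U l u -> eucl_dist u v ^+ 2 <= (d%:R * l) ^+ 2.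
  move=> Qu; rewrite ler_pXn2r ?nnegrE ?eucl_dist_ge0// ?(ltW dl0)//.
  exact: cube_diameter UU (ltW l0) Qu Qv.
rewrite -mulrA mulrDl; have [far|near] := leP (2 * (d%:R * l)) x.
  (* Since [|u - v|^2 <= (d l)^2 <= x^2 / 4], the squared triangle inequality leaves
     [x^2 / 2 <= 2 |u - w|^2]. *)
  have le_dist u : cube p U l u -> 2^-1 * x <= eucl_dist u w.
    move=> Qu; rewrite -(@ler_pXn2r _ 2)// ?nnegrE ?eucl_dist_ge0//; last first.
      by rewrite mulr_ge0// ltW.
    have := sqr_eucl_dist_triangle u v w.
    rewrite (eucl_distC v u) -/x => tri.
    have := diam u Qu; have : (2 * (d%:R * l)) ^+ 2 <= x ^+ 2.
      by rewrite ler_pXn2r ?nnegrE// ?ltW// mulr_gt0.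
    rewrite !exprMn; lra.
  apply: (@le_trans _ _ (K1 * (l ^+ d / l ^+ 2 * x `^ (2 + a)))%:E); last first.
    by rewrite lee_fin lerDl mulr_ge0.
  have [m muQ /andP[_ mle]] := cube_measure p UU l0.
  apply: (@le_trans _ _ (\int[mu]_(u in cube p U l) ((2^-1 * x) `^ a)%:E)%E).
    apply: ge0_le_integral => //.
    - by move=> u _; rewrite lee_fin powR_ge0.
    - by apply/measurable_EFinP; apply: measurable_funS (measurable_powR_eucl_distl a w).
    - move=> u Qu; rewrite lee_fin; apply: le0_ler_powR; rewrite ?(ltW a0)//.
        by rewrite mulr_gt0.
      exact: le_dist.
  rewrite integral_cst// [X in (_ * X)%E](_ : _ = m%:E)// -EFinM lee_fin.
  apply: (le_trans (ler_wpM2l (powR_ge0 _ _) mle)).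
  rewrite powRM ?(ltW x0)//.
  have -> : K1 * (l ^+ d / l ^+ 2 * x `^ (2 + a)) =
      2^-1 `^ a * (x `^ (2 + a) / (2 * (d%:R * l)) ^+ 2 * (2 * (d%:R * l)) ^+ d).
    rewrite /K1 !exprMn; field.
    by rewrite !pnatr_eq0 gt_eqF// -lt0n d_gt0.
  rewrite -[leLHS]mulrA ler_wpM2l ?powR_ge0// ler_wpM2r ?exprn_ge0 ?mulr_ge0 ?(ltW l0)//.
  rewrite ler_pdivlMr ?exprn_gt0 ?(mulr_gt0 _ dl0)// powR2D// mulrC ler_wpM2r ?powR_ge0//.
  by rewrite ler_pXn2r ?nnegrE// ?(ltW x0) ?mulr_ge0 ?(ltW l0).
apply: (@le_trans _ _ (K2 * (l ^+ d / l ^+ 2 * x `^ (2 + a)))%:E); last first.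
  by rewrite lee_fin lerDr mulr_ge0.
(* The squared triangle inequality gives [|u - w|^2 <= (2 + 8) (d l)^2], below [16 (d l)^2]. *)
pose r := 4 * (d%:R * l); have r0 : 0 < r by rewrite mulr_gt0.
apply: le_trans (Kle _ w r r0 mQ _) _ => [u Qu|].
  rewrite -(@ler_pXn2r _ 2)// ?nnegrE ?eucl_dist_ge0 ?(ltW r0)//.
  have := sqr_eucl_dist_triangle v u w; rewrite -/x => tri.
  have := diam u Qu; have : x ^+ 2 <= (2 * (d%:R * l)) ^+ 2.
    by rewrite ler_pXn2r ?nnegrE ?(ltW x0) ?(ltW near)// mulr_ge0// ltW.
  have := sqr_ge0 (d%:R * l); rewrite /r !exprMn; lra.
rewrite lee_fin.
have -> : K2 * (l ^+ d / l ^+ 2 * x `^ (2 + a)) =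
    K * (x `^ (2 + a) / r ^+ 2 * r ^+ d).
  rewrite /K2 /r !exprMn; field.
  by rewrite !pnatr_eq0 gt_eqF// -lt0n d_gt0.
rewrite ler_wpM2l// ler_wpM2r ?exprn_ge0 ?(ltW r0)//.
rewrite ler_pdivlMr ?exprn_gt0// mulrC -powR2D//.
apply: le0_ler_powR => //; first lra.
by rewrite (le_trans (ltW near))// ler_wpM2r ?(ltW dl0)// ler_nat.
Qed.

(* The point v is excepted because [0 `^ a = 0] for [a < 0]: the kernels have a
   junk value on the diagonal. *)
Lemma ge0_le_integral_off_point v (g1 g2 : Rn R d -> \bar R) :
  (forall w, 0 <= g1 w)%E -> (forall w, 0 <= g2 w)%E ->
  measurable_fun setT g1 -> measurable_fun setT g2 ->
  (forall w, w <> v -> g1 w <= g2 w)%E ->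
  (\int[mu]_w g1 w <= \int[mu]_w g2 w)%E.
Proof.
move=> g10 g20 mg1 mg2 le12; apply: ae_ge0_le_integral => //.
exists [set v]; split.
- by rewrite set1_box; exact: measurable_box.
- exact: lebesgue_tuple_set1.
- by move=> w /= nle; apply: contrapT => wv; apply: nle => _; exact: le12.
Qed.

Lemma integral_cube_density_le (f : Rn R d -> R) p U l v :
  (forall w, 0 <= f w) -> measurable_fun setT f ->
  U^T *m U = 1%:M -> 0 < l -> cube p U l v -> (2 <= d)%N ->
  (\int[mu]_(u in cube p U l) (f u)%:E <=
    (d%:R ^+ d / d%:R ^+ 2 * (l ^+ d / l ^+ 2))%:E *
    \int[mu]_w (f w * eucl_dist v w `^ (2 - d%:R))%:E)%E.
Proof.
move=> f0 mf UU l0 Qv d2; have mQ := measurable_cube p U l.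
have c0 : 0 <= d%:R ^+ d / d%:R ^+ 2 * (l ^+ d / l ^+ 2).
  by rewrite mulr_ge0// divr_ge0 ?exprn_ge0// ltW.
have mg : measurable_fun setT (fun w => (f w * eucl_dist v w `^ (2 - d%:R))%:E).
  apply/measurable_EFinP; apply: measurable_funM => //.
  exact: measurable_powR_eucl_distr.
rewrite -ge0_integralZl_EFin//; last first.
  by move=> w _; rewrite lee_fin mulr_ge0 ?powR_ge0.
rewrite [leLHS]integral_mkcond; apply: (@ge0_le_integral_off_point v).
- by move=> w; rewrite patchE; case: ifP; rewrite ?lee_fin.
- by move=> w; rewrite -EFinM lee_fin (mulr_ge0 c0)// mulr_ge0 ?powR_ge0.
- have : measurable_fun (cube p U l) (fun u => (f u)%:E).
    by apply/measurable_EFinP; apply: measurable_funS mf.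
  by move/(measurable_restrictT _ mQ).
- by apply: emeasurable_funM.
move=> w wv; rewrite patchE; case: ifPn => [|_]; last first.
  by rewrite -EFinM lee_fin (mulr_ge0 c0)// mulr_ge0 ?powR_ge0.
rewrite inE => Qw; rewrite -EFinM lee_fin mulrCA ler_peMr//.
have x0 : 0 < eucl_dist v w by apply: eucl_dist_gt0 => /esym.
have dl0 : 0 < d%:R * l by rewrite mulr_gt0// ltr0n.
(* The constant is [(d l)^(d-2)], the inverse of the least value that the kernel can take off the
   diagonal at distance at most [d l]. *)
have -> : d%:R ^+ d / d%:R ^+ 2 * (l ^+ d / l ^+ 2) =
    ((d%:R * l) `^ (2 - d%:R))^-1.
  rewrite powR2D// powRN powR_mulrn ?(ltW dl0)// !exprMn; field.
  by rewrite !expf_neq0 ?gt_eqF// ltr0n.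
rewrite mulrC ler_pdivlMr ?powR_gt0// mul1r; apply: le0_ler_powR => //.
  by rewrite subr_le0 ler_nat.
exact: cube_diameter UU (ltW l0) Qv Qw.
Qed.

Lemma integral_cube_potential_le (a : R) : - d%:R < a -> a <= - 2 ->
  exists2 K, 0 <= K & forall (f : Rn R d -> R) p U l v,
    (forall w, 0 <= f w) -> measurable_fun setT f ->
    U^T *m U = 1%:M -> 0 < l -> cube p U l v ->
    (\int[mu]_(u in cube p U l) \int[mu]_w (f w * eucl_dist u w `^ a)%:E <=
      (K * (l ^+ d / l ^+ 2))%:E *
      \int[mu]_w (f w * eucl_dist v w `^ (2 + a))%:E)%E.
Proof.
move=> da a2; have [K K0 Kle] := integral_cube_kernel_le da a2.
exists K => // f p U l v f0 mf UU l0 Qv; have mQ := measurable_cube p U l.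
(* The indicator turns the integral over the cube into one over the whole space, the form in which
   Tonelli applies. *)
pose F (z : Rn R d * Rn R d) : \bar R :=
  (\1_(cube p U l) z.1 * (f z.2 * eucl_dist z.1 z.2 `^ a))%:E.
have F0 z : (0 <= F z)%E by rewrite lee_fin !mulr_ge0 ?powR_ge0.
have mF : measurable_fun setT F.
  apply/measurable_EFinP; apply: measurable_funM.
    by apply: measurableT_comp => //; exact: measurable_indic.
  apply: measurable_funM; last exact: measurable_powR_eucl_dist.
  exact: measurableT_comp mf measurable_snd.
have -> : (\int[mu]_(u in cube p U l) \int[mu]_w (f w * eucl_dist u w `^ a)%:E =
    \int[mu]_u \int[mu]_w F (u, w))%E.
  rewrite [LHS]integral_mkcond; apply: eq_integral => u _; rewrite patchE /F/= indicE.
  case: ifPn => _; first by apply: eq_integral => w _; rewrite mul1r.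
  by rewrite integral0_eq// => w _; rewrite mul0r.
rewrite (fubini_tonelli F mF F0).
have c0 : 0 <= K * (l ^+ d / l ^+ 2).
  by rewrite mulr_ge0// divr_ge0 ?exprn_ge0// ltW.
have mg : measurable_fun setT (fun w => (f w * eucl_dist v w `^ (2 + a))%:E).
  apply/measurable_EFinP; apply: measurable_funM => //.
  exact: measurable_powR_eucl_distr.
rewrite -ge0_integralZl_EFin//; last first.
  by move=> w _; rewrite lee_fin mulr_ge0 ?powR_ge0.
apply: (@ge0_le_integral_off_point v).
- by move=> w; apply: integral_ge0.
- by move=> w; rewrite -EFinM lee_fin (mulr_ge0 c0)// mulr_ge0 ?powR_ge0.
- exact: (measurable_fun_fubini_tonelli_G F mF F0).
- by apply: emeasurable_funM.
move=> w wv.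
have -> : (\int[mu]_u F (u, w) =
    (f w)%:E * \int[mu]_(u in cube p U l) (eucl_dist u w `^ a)%:E)%E.
  rewrite [in RHS]integral_mkcond -ge0_integralZl_EFin//.
  - apply: eq_integral => u _; rewrite patchE /F/= indicE.
    by case: ifPn => _; rewrite ?mule0 ?mul0r// mul1r -EFinM.
  - by move=> u _; rewrite patchE; case: ifP => //; rewrite lee_fin powR_ge0.
  - have : measurable_fun (cube p U l) (fun u => (eucl_dist u w `^ a)%:E).
      by apply/measurable_EFinP; apply: measurable_funS (measurable_powR_eucl_distl a w).
    by move/(measurable_restrictT _ mQ).
apply: le_trans (lee_wpmul2l _ (Kle p U l v w UU l0 Qv wv)) _.
  by rewrite lee_fin.
by rewrite -!EFinM lee_fin mulrCA.
Qed.

End cube_kernel.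

(** * From the pointwise bound to averages *)

(** The integral of a non-negative function is a supremum over the simple functions below it, and
    this family grows with the integrand. It lets [1/a] be averaged without a measurability
    proof. *)
Lemma ge0_le_integral_nonmeasurable d (T : measurableType d) (R : realType)
    (mu : {measure set T -> \bar R}) (D : set T) (g1 g2 : T -> \bar R) :
  (forall x, D x -> 0 <= g1 x)%E -> (forall x, D x -> g1 x <= g2 x)%E ->
  (\int[mu]_(x in D) g1 x <= \int[mu]_(x in D) g2 x)%E.
Proof.
move=> g10 le12; rewrite !ge0_integralE//; last first.
  by move=> x Dx; exact: le_trans (g10 x Dx) (le12 x Dx).
apply: ereal_sup_le => _ [h hg <-]; exists h => // x.
apply: le_trans (hg x) _; rewrite !patchE; case: ifPn => //.
by rewrite inE; exact: le12.
Qed.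

Section averages.
Context {R : realType} {d : nat}.
Implicit Types (U : 'M[R]_d) (l : R).
Local Notation mu := (lebesgue_tuple R d).

Lemma measurable_potential (f : Rn R d -> R) a :
  (forall w, 0 <= f w) -> measurable_fun setT f ->
  measurable_fun setT (fun v => \int[mu]_w (f w * eucl_dist v w `^ a)%:E)%E.
Proof.
move=> f0 mf.
pose F (z : Rn R d * Rn R d) : \bar R := (f z.2 * eucl_dist z.1 z.2 `^ a)%:E.
have F0 z : (0 <= F z)%E by rewrite lee_fin mulr_ge0 ?powR_ge0.
apply: (measurable_fun_fubini_tonelli_F F _ F0).
apply/measurable_EFinP; apply: measurable_funM; last exact: measurable_powR_eucl_dist.
exact: measurableT_comp mf measurable_snd.
Qed.

Lemma integral_cube_h_coef_le (ch gamma : R) :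
  (2 <= d)%N -> 0 < ch -> - d%:R <= gamma -> gamma <= - 2 ->
  exists2 K, 0 <= K & forall (f : Rn R d -> R) p U l v,
    (forall w, 0 <= f w) -> measurable_fun setT f ->
    U^T *m U = 1%:M -> 0 < l -> cube p U l v ->
    (\int[mu]_(u in cube p U l) h_coef ch gamma f u <=
      (K * (l ^+ d / l ^+ 2))%:E *
      \int[mu]_w (f w * eucl_dist v w `^ (2 + gamma))%:E)%E.
Proof.
move=> d2 ch0 ge_d le_2; have d0 : (0 < d)%N := ltnW d2; rewrite /h_coef.
have [->|neq_d] := eqVneq gamma (- d%:R).
  exists (d%:R ^+ d / d%:R ^+ 2) => [|f p U l v f0 mf UU l0 Qv].
    by rewrite divr_ge0 ?exprn_ge0.
  exact: integral_cube_density_le.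
have [|K K0 Kle] := integral_cube_potential_le d0 _ le_2.
  by rewrite lt_neqAle eq_sym neq_d ge_d.
exists (ch * K) => [|f p U l v f0 mf UU l0 Qv]; first by rewrite mulr_ge0 ?(ltW ch0).
rewrite ge0_integralZl_EFin ?(ltW ch0)//.
- by rewrite -mulrA EFinM -muleA lee_wpmul2l ?lee_fin ?(ltW ch0)//; exact: Kle.
- exact: measurable_cube.
- by move=> u _; apply: integral_ge0 => w _; rewrite lee_fin mulr_ge0 ?powR_ge0.
- exact: measurable_funS (measurable_potential gamma f0 mf).
Qed.

(** With [M = |Q|^(1/d)], the hypothesis reads [1/a <= k / (M^2 H)] on [Q]; averaging and taking
    roots, [M H^(1/2)] cancels. [H] is kept abstract to isolate the degenerate values 0 and
    [+oo]. *)
Lemma avg_inv_le (Q : set (Rn R d)) (a : Rn R d -> \bar R) (H : \bar R) (m k : R) :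
  measurable Q -> mu Q = m%:E -> 0 < m -> 0 < k ->
  (0 <= H)%E -> (forall v, 0 <= a v)%E ->
  (forall v, Q v -> ((m `^ d%:R^-1) ^+ 2)%:E * H <= k%:E * a v)%E ->
  (mu Q `^ d%:R^-1 * H `^ 2^-1 * avg Q (fun v => (a v)^-1) `^ 2^-1
    <= (k `^ 2^-1)%:E)%E.
Proof.
move=> mQ muQ m0 k0 H0 a0 Ha; rewrite muQ poweR_EFin.
set M := m `^ d%:R^-1; have M0 : 0 < M by rewrite powR_gt0.
have rhs0 : (0 <= (k `^ 2^-1)%:E)%E by rewrite lee_fin powR_ge0.
(* If [H = +oo], then [a = +oo] on [Q], so [1/a] averages to 0 and the product is 0 by the
   convention [0 * oo = 0]. *)
case: H H0 Ha => [h|_ Ha|//]; last first.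
  rewrite (_ : avg _ _ = 0%E); first by rewrite poweR0r ?invr_neq0// mule0.
  rewrite /avg integral0_eq ?mule0// => v Qv; apply/eqP; rewrite inve_eq0.
  have := Ha v Qv; rewrite gt0_muley ?lte_fin ?exprn_gt0// leye_eq.
  by case: (a v) (a0 v) => [x|//|//]; rewrite -EFinM.
(* If [H = 0], the same convention makes the product 0, even when the average of [1/a] is
   infinite. *)
rewrite lee_fin le_eqVlt => /predU1P[<- _|h0 Ha].
  by rewrite poweR0r ?invr_neq0// mule0 mul0e.
pose t := M ^+ 2 * h / k.
have t0 : 0 < t by rewrite divr_gt0// mulr_gt0// exprn_gt0.
have ta v : Q v -> (t%:E <= a v)%E.
  move=> /Ha; case: (a v) (a0 v) => [x _|_ _|//]; last by rewrite leey.
  by rewrite -!EFinM !lee_fin /t ler_pdivrMr// (mulrC k).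
have avg_le : (avg Q (fun v => (a v)^-1) <= (t^-1)%:E)%E.
  have -> : (t^-1)%:E = ((mu Q)^-1 * (\int[mu]_(v in Q) (t^-1)%:E))%E.
    rewrite integral_cst// muQ inver (gt_eqF m0) [X in (_ * (_ * X))%E](_ : _ = m%:E)//.
    by rewrite -!EFinM mulrCA mulVf ?mulr1// gt_eqF.
  rewrite /avg lee_wpmul2l ?inve_ge0//.
  apply: ge0_le_integral_nonmeasurable => v Qv; first by rewrite inve_ge0.
  have -> : (t^-1)%:E = (t%:E)^-1%E by rewrite inver gt_eqF.
  by rewrite lee_pV2 ?inE ?lee_fin ?ta// ltW.
have avg0 : (0 <= avg Q (fun v => (a v)^-1))%E.
  by rewrite mule_ge0 ?inve_ge0//; apply: integral_ge0 => v _; rewrite inve_ge0.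
rewrite poweR_EFin -EFinM.
apply: (@le_trans _ _ ((M * h `^ 2^-1)%:E * (t^-1)%:E `^ 2^-1)%E).
  rewrite lee_wpmul2l ?lee_fin ?mulr_ge0 ?powR_ge0//.
  by apply: gt0_ler_poweR; rewrite ?in_itv/= ?avg0 ?leey ?lee_fin ?invr_ge0 ?(ltW t0).
rewrite poweR_EFin -EFinM lee_fin.
(* Writing [M] as the root of its square puts everything under one power [1/2], with base
   [M^2 h / t = k]. *)
have -> : M = (M ^+ 2) `^ 2^-1 by rewrite powR12_sqrt ?sqr_ge0// sqrtr_sqr gtr0_norm.
rewrite -!powRM ?mulr_ge0 ?sqr_ge0 ?invr_ge0 ?(ltW M0) ?(ltW h0) ?(ltW t0)//.
by rewrite le_eqVlt; apply/orP; left; apply/eqP; congr (_ `^ _); rewrite /t; field;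
  rewrite !gt_eqF.
Qed.

End averages.

(** * Assembly of the constant *)

Theorem proposition2p14 (R : realType) (d : nat) (d_ge3 : (3 <= d)%N)
    (gamma : R) (gamma_ge : - d%:R <= gamma) (gamma_le : gamma <= - 2)
    (Ca ch : R) (Ca_gt0 : 0 < Ca) (ch_gt0 : 0 < ch) :
  exists C : R,
    forall (f : d.-tuple (measurableTypeR R) -> R),
      (forall v, 0 <= f v) ->
      (lebesgue_tuple R d).-integrable [set: d.-tuple (measurableTypeR R)]
        (EFin \o f) ->
      ~ {ae lebesgue_tuple R d, forall v, f v = 0} ->
    forall Q : set (d.-tuple (measurableTypeR R)), is_cube Q ->
      (lebesgue_tuple R d Q `^ (d%:R^-1)
        * avg Q (h_coef ch gamma f) `^ (2^-1)
        * avg Q (fun v => (a_coef Ca gamma f v)^-1) `^ (2^-1) <= C%:E)%E.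
Proof.
have d0 : (0 < d)%N by apply: leq_trans d_ge3.
have dR0 : 0 < d%:R :> R by rewrite ltr0n.
have dR_neq0 := lt0r_neq0 dR0.
have [K K0 Kle] := integral_cube_h_coef_le (ltnW d_ge3) ch_gt0 gamma_ge gamma_le.
(* The factors are [(2 d l)^2] for [|Q|^(2/d)], [(d/l)^d] for [1/|Q|] and [K l^(d-2)] for the
   integral of [h]; the powers of [l] cancel. Dividing by [Ca] passes from the bare integral to
   [a]. *)
pose k := (2 * d%:R) ^+ 2 * d%:R ^+ d * K / Ca.
have k0 : 0 <= k by rewrite divr_ge0 ?mulr_ge0 ?exprn_ge0 ?mulr_ge0 ?(ltW Ca_gt0).
(* [k] may vanish, while [avg_inv_le] asks for a positive constant; hence [k + 1]. *)
exists ((k + 1) `^ 2^-1) => f f0 /measurable_int/measurable_EFinP mf _ Q.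
move=> [p [U [l [UU l0 ->]]]].
have [m muQ /andP[m_ge m_le]] := cube_measure p UU l0.
have m0 : 0 < m by apply: lt_le_trans m_ge; rewrite exprn_gt0// divr_gt0.
have pot0 v a : (0 <= \int[lebesgue_tuple R d]_w (f w * eucl_dist v w `^ a)%:E)%E.
  by apply: integral_ge0 => w _; rewrite lee_fin mulr_ge0 ?powR_ge0.
have h0 v : (0 <= h_coef ch gamma f v)%E.
  by rewrite /h_coef; case: ifP; rewrite ?lee_fin// mule_ge0 ?lee_fin ?(ltW ch_gt0).
apply: (avg_inv_le (m := m)) => //.
- exact: measurable_cube.
- by rewrite ltr_wpDl.
- by rewrite mule_ge0 ?inve_ge0// integral_ge0.
- by move=> v; rewrite mule_ge0 ?lee_fin ?(ltW Ca_gt0).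
move=> v Qv; rewrite /avg /a_coef muQ inver (gt_eqF m0).
set I := (\int[_]_w (f w * _)%:E)%E; have I0 : (0 <= I)%E by exact: pot0.
have M_le : m `^ d%:R^-1 <= 2 * d%:R * l.
  rewrite [leRHS](_ : _ = ((2 * d%:R * l) `^ d%:R) `^ d%:R^-1); last first.
    by rewrite -powRrM mulfV// powRr1// ?mulr_ge0 ?(ltW l0).
  apply: ge0_ler_powR; rewrite ?nnegrE ?invr_ge0 ?powR_ge0 ?(ltW m0)//.
  by rewrite powR_mulrn ?mulr_ge0 ?(ltW l0)// -mulrA.
apply: (@le_trans _ _ (((2 * d%:R * l) ^+ 2)%:E *
    (((l / d%:R) ^+ d)^-1%:E * ((K * (l ^+ d / l ^+ 2))%:E * I)))%E).
  apply: lee_pmul.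
  - by rewrite lee_fin sqr_ge0.
  - by rewrite mule_ge0 ?lee_fin ?invr_ge0 ?(ltW m0)// integral_ge0.
  - by rewrite lee_fin ler_pXn2r ?nnegrE ?powR_ge0 ?mulr_ge0 ?(ltW l0).
  apply: lee_pmul.
  - by rewrite lee_fin invr_ge0 ltW.
  - exact: integral_ge0.
  - by rewrite lee_fin lef_pV2 ?posrE// exprn_gt0// divr_gt0.
  exact: Kle.
rewrite !muleA -!EFinM lee_wpmul2r// lee_fin.
have -> : (2 * d%:R * l) ^+ 2 / (l / d%:R) ^+ d * (K * (l ^+ d / l ^+ 2)) = k * Ca.
  rewrite /k !exprMn exprVn; field.
  by rewrite ?expf_neq0 ?(gt_eqF l0) ?(gt_eqF dR0) ?(gt_eqF Ca_gt0).
by rewrite ler_wpM2r ?(ltW Ca_gt0)// lerDl.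
Qed.
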